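(* Let $(\bar A,\bar B)$ be a structurally controllable structured system with $n$ states and $m$ inputs, let $p_u(j)\ge 0$, $j=1,\dots,m$, be input costs, and let $q$ be the number of non-top linked SCC's of $D(\bar A)$. Let $f$ be a feasible solution to MCFF$(q+n)$ on $F(\bar A,\bar B,c)$ and let $\mathcal I_f=\{j:f((u'_j,t))>0\}$. Then for any $\epsilon\ge1$, $c_f\le\epsilon\,c^\star$ implies $p(\mathcal I_f)\le\epsilon\,p^\star$.
   Context: Structured systems. A structured system is a pair $(\bar A,\bar B)$ with $\bar A\in\{0,\star\}^{n\times n}$, $\bar B\in\{0,\star\}^{n\times m}$. A numerical realization is a pair of real matrices $(A,B)$ of the same sizes with $A_{ij}=0$ whenever $\bar A_{ij}=0$ and $B_{ij}=0$ whenever $\bar B_{ij}=0$. $(\bar A,\bar B)$ is structurally controllable if some numerical realization $(A,B)$ is controllable, i.e. $\mathrm{rank}[B\ AB\ \cdots\ A^{n-1}B]=n$. For $\mathcal W\subseteq\{1,\dots,m\}$, $\bar B_{\mathcal W}$ is the restriction of $\bar B$ to the columns indexed by $\mathcal W$. minCCIS. Let $\mathcal K=\{\mathcal W\subseteq\{1,\dots,m\}:(\bar A,\bar B_{\mathcal W})\text{ is structurally controllable}\}$ and $p(\mathcal I)=\sum_{j\in\mathcal I}p_u(j)$. The minimum cost constrained input selection problem (minCCIS) asks for a minimizer of $p$ over $\mathcal K$; $p^\star=\min_{\mathcal I\in\mathcal K}p(\mathcal I)$. State digraph and SCC's. $D(\bar A)$ has vertices $x_1,\dots,x_n$ and a directed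 edge $(x_j,x_i)$ iff $\bar A_{ij}\ne 0$. SCC means strongly connected component; an SCC is non-top linked if it has no incoming edges to its vertices from vertices of another SCC. Let $\mathcal N_1,\dots,\mathcal N_q$ be the non-top linked SCC's of $D(\bar A)$. Flow network $F(\bar A,\bar B,c)$. Vertex set $V_F=\{s,t\}\cup\{\mathcal N_i\}_{i=1}^q\cup\{x'_k\}_{k=1}^n\cup\{x_r\}_{r=1}^n\cup\{u_j\}_{j=1}^m\cup\{u'_j\}_{j=1}^m$ with source $s$ and sink $t$. Directed edge set $E_F$: $(s,\mathcal N_i)$ for all $i$; $(s,x'_k)$ for all $k$; $(\mathcal N_i,u'_j)$ whenever $\bar B_{rj}=\star$ for some $x_r\in\mathcal N_i$; $(x'_k,x_r)$ whenever $\bar A_{kr}\neq0$; $(x'_k,u_j)$ whenever $\bar B_{kj}\ne0$; $(u_j,u'_j)$ for all $j$; $(u'_j,t)$ for all $j$; $(x_r,t)$ for all $r$. Capacities: $b((u'_j,t))=n+1$ for all $j$, and $b(e)=1$ for every other edge. Costs: $c((u'_j,t))=p_u(j)$ for all $j$, and $c(e)=0$ for every other edge. Flows and MCFF. A flow vector is a function $f:E_F\to\mathbb R_{\ge0}$. It is feasible if $f(e)\le b(e)$ for all $e$ and, at every vertex other than $s,t$, total outgoing flow equals total incoming flow. Put $\varphi_f=\sum_{e=(s,v)\in E_F}f(e)$ and $c_f=\sum_{e:f(e)>0}c(e)$. The minimum cost fixed flow problem MCFF$(q+n)$ is: minimize $c_f$ over feasible flow vectors $f$ with $\varphi_f\ge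 q+n$; any feasible flow vector $f$ with $\varphi_f\ge q+n$ is a feasible solution to MCFF$(q+n)$. The optimal value is $c^\star$. *)

(* Defs.v *)
From HB Require Import structures.
From mathcomp Require Import all_boot all_order all_algebra.
From mathcomp Require Import classical_sets reals.
Set Implicit Arguments.
Unset Strict Implicit.
Unset Printing Implicit Defensive.
Import Order.TTheory GRing.Theory Num.Theory.
Local Open Scope ring_scope.

(* The minimum of S; the default value 0 is only used when S has no minimum. *)
Definition minimum (R : realType) (S : set R) : R :=
  xget 0 (fun v => S v /\ lbound S v).

Lemma minimumE (R : realType) (S : set R) (v : R) :
  S v -> lbound S v -> minimum S = v.
Proof.
move=> Sv lbv; apply: xget_unique => // w [Sw lbw].
by apply/eqP; rewrite eq_le lbw ?lbv.
Qed.

(* Patterns over {0, *} are boolean matrices, with [true] standing for *. *)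
Definition realizes (R : realType) (a b : nat) (Mbar : 'M[bool]_(a, b))
    (M : 'M[R]_(a, b)) : Prop :=
  forall i j, Mbar i j = false -> M i j = 0.

Definition controllability_mx (R : realType) (n m : nat) (A : 'M[R]_n)
    (B : 'M[R]_(n, m)) : 'M[R]_(n, \sum_(k < n) m) :=
  \mxrow_(k < n) (A ^+ k *m B).

Definition controllable (R : realType) (n m : nat) (A : 'M[R]_n)
    (B : 'M[R]_(n, m)) : Prop :=
  \rank (controllability_mx A B) = n.

Definition structurally_controllable (R : realType) (n m : nat)
    (Abar : 'M[bool]_n) (Bbar : 'M[bool]_(n, m)) : Prop :=
  exists (A : 'M[R]_n) (B : 'M[R]_(n, m)),
    [/\ realizes Abar A, realizes Bbar B & controllable A B].

Definition restrict_inputs (n m : nat) (Bbar : 'M[bool]_(n, m))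
    (W : {set 'I_m}) : 'M[bool]_(n, #|W|) :=
  colsub (fun k : 'I_#|W| => enum_val k) Bbar.

Definition input_cost (R : realType) (m : nat) (pu : 'I_m -> R)
    (I : {set 'I_m}) : R :=
  \sum_(j in I) pu j.

Definition controlling_inputs (R : realType) (n m : nat)
    (Abar : 'M[bool]_n) (Bbar : 'M[bool]_(n, m)) : set {set 'I_m} :=
  fun W => structurally_controllable R Abar (restrict_inputs Bbar W).

Definition minCCIS_opt (R : realType) (n m : nat) (Abar : 'M[bool]_n)
    (Bbar : 'M[bool]_(n, m)) (pu : 'I_m -> R) : R :=
  minimum (input_cost pu @` controlling_inputs R Abar Bbar)%classic.

(* [state_edge Abar j i] is the edge from x_j to x_i. *)
Definition state_edge (n : nat) (Abar : 'M[bool]_n) : rel 'I_n :=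
  fun j i => Abar i j.

Definition strongly_connected (n : nat) (Abar : 'M[bool]_n) : rel 'I_n :=
  fun x y => connect (state_edge Abar) x y && connect (state_edge Abar) y x.

Definition sccs (n : nat) (Abar : 'M[bool]_n) : {set {set 'I_n}} :=
  equivalence_partition (strongly_connected Abar) [set: 'I_n].

Definition non_top_linked (n : nat) (Abar : 'M[bool]_n) (C : {set 'I_n}) :=
  [forall C' in sccs Abar, (C' != C) ==>
    [forall x in C', forall y in C, ~~ state_edge Abar x y]].

Definition ntl_sccs (n : nat) (Abar : 'M[bool]_n) : {set {set 'I_n}} :=
  [set C in sccs Abar | non_top_linked Abar C].

Definition ntl_scc (n : nat) (Abar : 'M[bool]_n) (i : 'I_#|ntl_sccs Abar|) :
    {set 'I_n} :=
  enum_val i.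

(* The vertices s, t, N_i, x'_k, x_r, u_j, u'_j of the flow network. *)
Inductive vertex (n m q : nat) : Type :=
  | Source
  | Sink
  | SccV of 'I_q
  | StateL of 'I_n
  | StateR of 'I_n
  | InputL of 'I_m
  | InputR of 'I_m.
Arguments Source {n m q}.
Arguments Sink {n m q}.
Arguments SccV {n m q} _.
Arguments StateL {n m q} _.
Arguments StateR {n m q} _.
Arguments InputL {n m q} _.
Arguments InputR {n m q} _.

Definition vertex_code (n m q : nat) (v : vertex n m q) :
    option (option ('I_q + (('I_n + 'I_n) + ('I_m + 'I_m)))) :=
  match v with
  | Source => None
  | Sink => Some None
  | SccV i => Some (Some (inl i))
  | StateL k => Some (Some (inr (inl (inl k))))
  | StateR r => Some (Some (inr (inl (inr r))))
  | InputL j => Some (Some (inr (inr (inl j))))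
  | InputR j => Some (Some (inr (inr (inr j))))
  end.

Definition vertex_decode (n m q : nat)
    (c : option (option ('I_q + (('I_n + 'I_n) + ('I_m + 'I_m))))) :
    vertex n m q :=
  match c with
  | None => Source
  | Some None => Sink
  | Some (Some (inl i)) => SccV i
  | Some (Some (inr (inl (inl k)))) => StateL k
  | Some (Some (inr (inl (inr r)))) => StateR r
  | Some (Some (inr (inr (inl j)))) => InputL j
  | Some (Some (inr (inr (inr j)))) => InputR j
  end.

Lemma vertex_codeK (n m q : nat) :
  cancel (@vertex_code n m q) (@vertex_decode n m q).
Proof. by case. Qed.

HB.instance Definition _ (n m q : nat) :=
  Countable.copy (vertex n m q) (can_type (@vertex_codeK n m q)).
HB.instance Definition _ (n m q : nat) : isFinite (vertex n m q) :=
  CanIsFinite (@vertex_codeK n m q).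

Definition net_vertex (n m : nat) (Abar : 'M[bool]_n)
    (Bbar : 'M[bool]_(n, m)) : finType :=
  vertex n m #|ntl_sccs Abar|.

Definition net_rel (n m : nat) (Abar : 'M[bool]_n) (Bbar : 'M[bool]_(n, m))
    (v w : net_vertex Abar Bbar) : bool :=
  match v, w with
  | Source, SccV _ => true
  | Source, StateL _ => true
  | SccV i, InputR j => [exists r in ntl_scc i, Bbar r j]
  | StateL k, StateR r => Abar k r
  | StateL k, InputL j => Bbar k j
  | InputL j, InputR j' => j == j'
  | InputR _, Sink => true
  | StateR _, Sink => true
  | _, _ => false
  end.

Definition net_edge (n m : nat) (Abar : 'M[bool]_n)
    (Bbar : 'M[bool]_(n, m)) : finType :=
  {e : net_vertex Abar Bbar * net_vertex Abar Bbar | net_rel e.1 e.2}.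

Definition tail (n m : nat) (Abar : 'M[bool]_n) (Bbar : 'M[bool]_(n, m))
    (e : net_edge Abar Bbar) : net_vertex Abar Bbar := (val e).1.

Definition head (n m : nat) (Abar : 'M[bool]_n) (Bbar : 'M[bool]_(n, m))
    (e : net_edge Abar Bbar) : net_vertex Abar Bbar := (val e).2.

Definition input_sink_edge (n m : nat) (Abar : 'M[bool]_n)
    (Bbar : 'M[bool]_(n, m)) (j : 'I_m) : net_edge Abar Bbar :=
  exist (fun e : net_vertex Abar Bbar * net_vertex Abar Bbar =>
           net_rel e.1 e.2)
        (InputR j, Sink) isT.

Definition capacity (R : realType) (n m : nat) (Abar : 'M[bool]_n)
    (Bbar : 'M[bool]_(n, m)) (e : net_edge Abar Bbar) : R :=
  match tail e, head e with
  | InputR _, Sink => n.+1%:R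
  | _, _ => 1
  end.

Definition edge_cost (R : realType) (n m : nat) (Abar : 'M[bool]_n)
    (Bbar : 'M[bool]_(n, m)) (pu : 'I_m -> R) (e : net_edge Abar Bbar) : R :=
  match tail e, head e with
  | InputR j, Sink => pu j
  | _, _ => 0
  end.

Definition outflow (R : realType) (n m : nat) (Abar : 'M[bool]_n)
    (Bbar : 'M[bool]_(n, m)) (f : net_edge Abar Bbar -> R)
    (v : net_vertex Abar Bbar) : R :=
  \sum_(e : net_edge Abar Bbar | tail e == v) f e.

Definition inflow (R : realType) (n m : nat) (Abar : 'M[bool]_n)
    (Bbar : 'M[bool]_(n, m)) (f : net_edge Abar Bbar -> R)
    (v : net_vertex Abar Bbar) : R :=
  \sum_(e : net_edge Abar Bbar | head e == v) f e.

Definition feasible_flow (R : realType) (n m : nat) (Abar : 'M[bool]_n)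
    (Bbar : 'M[bool]_(n, m)) (f : net_edge Abar Bbar -> R) : Prop :=
  [/\ forall e, 0 <= f e,
      forall e, f e <= capacity R e
    & forall v : net_vertex Abar Bbar, v <> Source -> v <> Sink ->
        outflow f v = inflow f v].

Definition flow_value (R : realType) (n m : nat) (Abar : 'M[bool]_n)
    (Bbar : 'M[bool]_(n, m)) (f : net_edge Abar Bbar -> R) : R :=
  outflow f Source.

Definition flow_cost (R : realType) (n m : nat) (Abar : 'M[bool]_n)
    (Bbar : 'M[bool]_(n, m)) (pu : 'I_m -> R)
    (f : net_edge Abar Bbar -> R) : R :=
  \sum_(e : net_edge Abar Bbar | 0 < f e) edge_cost pu e.

Definition MCFF_feasible (R : realType) (n m : nat) (Abar : 'M[bool]_n)
    (Bbar : 'M[bool]_(n, m)) (d : nat) : set (net_edge Abar Bbar -> R) :=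
  fun f => feasible_flow f /\ d%:R <= flow_value f.

Definition MCFF_opt (R : realType) (n m : nat) (Abar : 'M[bool]_n)
    (Bbar : 'M[bool]_(n, m)) (pu : 'I_m -> R) (d : nat) : R :=
  minimum (flow_cost pu @` @MCFF_feasible R n m Abar Bbar d)%classic.

Definition selected_inputs (R : realType) (n m : nat) (Abar : 'M[bool]_n)
    (Bbar : 'M[bool]_(n, m)) (f : net_edge Abar Bbar -> R) : {set 'I_m} :=
  [set j | 0 < f (input_sink_edge Abar Bbar j)].

(* Main.v *)
Require Import Defs.
From mathcomp Require Import all_boot fingroup perm all_order all_algebra.
From mathcomp Require Import classical_sets reals boolp.
Import Order.TTheory GRing.Theory Num.Theory.
Local Open Scope ring_scope.

(** Both optimal values are minima of [input_cost] over a family of input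
    sets: the cost of a flow is the cost of the inputs that it selects, because
    only the edges from [InputR j] to the sink cost anything ([flow_costE]).
    Hence the approximation guarantee carries over as soon as the optimum of
    the flow problem is at most the optimum of the input selection problem, and
    for this it suffices that every controlling input set [W] carries a feasible
    flow of value [#|ntl_sccs Abar| + n] selecting only inputs of [W]
    ([controlling_flow]).

    Such a flow comes from two necessary conditions for structural
    controllability. First, every non-top linked component contains a state
    driven directly by an input ([ntl_scc_input]): otherwise the corresponding
    rows of all the matrices [A ^+ k *m B] vanish. Second, the states inject
    into the states and inputs along the edges of the system
    ([state_matching]): the matrix [row_mx A B] has full row rank, so some
    maximal minor is nonzero, and so is some term of its expansion. Each
    component and each state then gets one route from the source to the sink,
    and the superposition of these routes is the flow. The routes are disjoint
    away from the source, the sink and the vertices [InputR j], which gives the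
    capacity constraints. *)

(** * Minima over finitely many candidates *)

Lemma minimum_attained {R : realType} {T : finType} (G : T -> R) (P : set T) :
  (P !=set0)%classic ->
  exists2 x, P x &
    minimum (G @` P)%classic = G x /\ forall y, P y -> G x <= G y.
Proof.
case=> x0 Px0; have Px0b : `[< P x0 >] by apply/asboolP.
case: (@arg_minP _ _ _ x0 (fun x => `[< P x >]) G Px0b) => x /asboolP Px xmin.
have xle y : P y -> G x <= G y by move=> Py; apply: xmin; apply/asboolP.
exists x => //; split=> //.
by apply: minimumE => [|_ [y Py <-]]; [exists x | exact: xle].
Qed.

(** * Necessary conditions for structural controllability *)

(** The Kalman rank condition, dualized: no nonzero row vector annihilates all
    the blocks. In this form, zero rows and renumbered columns are
    immediate to handle. *)
Lemma controllableP {R : realType} {n m : nat} (A : 'M[R]_n) (B : 'M[R]_(n, m)) :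
  controllable A B <->
  forall v : 'rV_n, (forall k : 'I_n, v *m (A ^+ k *m B) = 0) -> v = 0.
Proof.
have kerE (v : 'rV_n) :
    v *m controllability_mx A B = 0 <-> forall k : 'I_n, v *m (A ^+ k *m B) = 0.
  rewrite /controllability_mx mul_mxrow; split=> [v0 k|v0].
    rewrite -(mxrowK (fun k : 'I_n => v *m (A ^+ k *m B)) k) v0.
    by apply/matrixP=> i j; rewrite !mxE.
  by rewrite (eq_mxrow v0) mxrow0.
split=> [/eqP ctrl v /kerE v0|ker0].
  by apply/eqP; rewrite -(mulmx_free_eq0 v ctrl); apply/eqP.
by apply/eqP; apply: inj_row_free => v /kerE /ker0.
Qed.

(** Restricting to all the inputs only renumbers the columns; this provides a
    controlling input set, without which the optimum would be a default
    value. *)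
Lemma structurally_controllable_setT {R : realType} {n m : nat}
    (Abar : 'M[bool]_n) (Bbar : 'M[bool]_(n, m)) :
  structurally_controllable R Abar Bbar ->
  structurally_controllable R Abar (restrict_inputs Bbar [set: 'I_m]).
Proof.
case=> A [B [rA rB /controllableP ctrl]].
exists A, (colsub (fun k : 'I_#|[set: 'I_m]| => enum_val k) B); split=> //.
  by move=> i k; rewrite !mxE => /rB.
apply/controllableP => v v0; apply: ctrl => k; apply/matrixP => i j.
move/matrixP: (v0 k) => /(_ i (enum_rank_in (finset.in_setT j) j)).
by rewrite !mulmx_colsub mxE enum_rankK_in ?inE // !mxE.
Qed.

Lemma sccs_partition {n : nat} (Abar : 'M[bool]_n) :
  finset.partition (sccs Abar) [set: 'I_n].
Proof.
apply: equivalence_partitionP => x y z _ _ _; split=> [|/andP[xy yx]].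
  by rewrite /strongly_connected connect0.
apply/andP/andP=> -[cxz czx]; split.
- exact: connect_trans yx cxz.
- exact: connect_trans czx xy.
- exact: connect_trans xy cxz.
- exact: connect_trans czx yx.
Qed.

(** An edge into [C] from outside would come from another component. *)
Lemma ntl_scc_closed {n : nat} {Abar : 'M[bool]_n} {C : {set 'I_n}} (x y : 'I_n) :
  C \in ntl_sccs Abar -> y \in C -> Abar y x -> x \in C.
Proof.
rewrite inE => /andP[_ /'forall_implyP ntl] yC Ayx.
case/and3P: (sccs_partition Abar) => /eqP covT _ _.
have xcov : x \in finset.cover (sccs Abar) by rewrite covT finset.in_setT.
have C'scc := finset.pblock_mem xcov; move: xcov; rewrite -finset.mem_pblock.
set C' := finset.pblock _ x in C'scc * => xC'.
have [<- //|C'C] := eqVneq C' C.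
move: (ntl _ C'scc) => /implyP/(_ C'C)/'forall_implyP/(_ _ xC').
by move=> /'forall_implyP/(_ _ yC); rewrite /state_edge Ayx.
Qed.

Lemma card_ntl_sccs {n : nat} (Abar : 'M[bool]_n) : (#|ntl_sccs Abar| <= n)%N.
Proof.
have part := sccs_partition Abar.
rewrite -[leqRHS]card_ord -cardsT (card_partition part).
apply: (@leq_trans #|sccs Abar|).
  by apply/subset_leq_card/fintype.subsetP => C; rewrite inE => /andP[].
rewrite -sum1_card; apply: leq_sum => C Cscc.
by rewrite card_gt0; case/and3P: part => _ _ /memPn; apply.
Qed.

(** Without a driven state in [C], the rows of [A ^+ k *m B] indexed by [C] are
    zero by induction on [k], since the states of [C] depend only on states of
    [C]. *)
Lemma ntl_scc_input {R : realType} {n m : nat} {Abar : 'M[bool]_n}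
    {Bbar : 'M[bool]_(n, m)} {C : {set 'I_n}} :
  structurally_controllable R Abar Bbar -> C \in ntl_sccs Abar ->
  exists j, [exists r in C, Bbar r j].
Proof.
move=> [A [B [rA rB /controllableP ctrl]]] Cntl.
apply/existsP; apply: contraT => /existsPn noin.
have B0 y j : y \in C -> B y j = 0.
  move=> yC; apply: rB; apply: negbTE.
  by move: (noin j) => /existsPn/(_ y); rewrite yC.
have AB0 k : forall y j, y \in C -> (A ^+ k *m B) y j = 0.
  elim: k => [|k IH] y j yC; first by rewrite expr0 mul1mx B0.
  rewrite exprS -mulmxE -mulmxA mxE big1 // => x _.
  case Ayx : (Abar y x); last by rewrite rA ?mul0r.
  by rewrite IH ?mulr0 // (ntl_scc_closed _ _ Cntl yC Ayx).
have /set0Pn[y yC] : C != finset.set0.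
  case/and3P: (sccs_partition Abar) => _ _ /memPn; apply.
  by move: Cntl; rewrite inE => /andP[].
have /(congr1 (fun v : 'rV[R]_n => v 0 y)) : (delta_mx 0 y : 'rV[R]_n) = 0.
  by apply: ctrl => k; rewrite -rowE; apply/rowP => j; rewrite mxE AB0 // !mxE.
by rewrite !mxE !eqxx => /eqP; rewrite oner_eq0.
Qed.

(** Some term of the Leibniz expansion of the determinant is nonzero. *)
Lemma unitmx_transversal {F : fieldType} {n : nat} (M : 'M[F]_n) :
  M \in unitmx -> exists s : {perm 'I_n}, forall i, M i (s i) != 0.
Proof.
rewrite unitmxE unitfE => /negP nz.
have [/existsP[s /forallP sP]|/existsPn no] :=
  boolP [exists s : {perm 'I_n}, forall i, M i (s i) != 0]; first by exists s.
case: nz; rewrite /determinant big1 // => s _.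
have /forallPn[i /negPn/eqP Mi0] := no s.
by rewrite (bigD1 i) //= Mi0 mul0r mulr0.
Qed.

(** The column [c] of [row_mx Abar Bbar] has a star in row [k]. *)
Definition feeds {n m : nat} (Abar : 'M[bool]_n) (Bbar : 'M[bool]_(n, m))
    (c : 'I_n + 'I_m) (k : 'I_n) : bool :=
  match c with inl r => Abar k r | inr j => Bbar k j end.

(** A row vector annihilating both [A] and [B] annihilates every block of the
    controllability matrix, so controllability makes [row_mx A B] row free. *)
Lemma state_matching {R : realType} {n m : nat} {Abar : 'M[bool]_n}
    {Bbar : 'M[bool]_(n, m)} :
  structurally_controllable R Abar Bbar ->
  exists2 g : 'I_n -> 'I_n + 'I_m, injective g &
    forall k, feeds Abar Bbar (g k) k.
Proof.
move=> [A [B [rA rB /controllableP ctrl]]].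
have full : row_full (row_mx A B)^T.
  rewrite /row_full mxrank_tr; apply: inj_row_free => v.
  rewrite mul_mx_row -row_mx0 => /eq_row_mx[vA vB]; apply: ctrl => -[k _] /=.
  case: k => [|k]; first by rewrite expr0 mul1mx.
  by rewrite exprS -mulmxE !mulmxA vA !mul0mx.
have [s sP] := unitmx_transversal _ (fullrowsub_unit full).
pose c k := fullrankfun full ((s^-1)%g k).
exists (fun k => split (c k)).
  by move=> k l /(can_inj splitK) /fullrankfun_inj /perm_inj.
move=> k; have := sP ((s^-1)%g k); rewrite permKV !mxE -/(c k) /feeds.
case: (split (c k)) => [r|j]; apply: contraR => /negbTE.
  by move=> /rA ->.
by move=> /rB ->.
Qed.

(** * Flows carried by families of routes *)

(** Double counting of the occurrences in [s] of the arcs [a] with [h a = v];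
    with [h] a projection, this turns flow sums into vertex counts. *)
Lemma sum_count_mem {T : finType} (Q : pred (T * T)) (h : T * T -> T)
    (s : seq (T * T)) (v : T) :
  all Q s ->
  (\sum_(a : {x | Q x} | h (val a) == v) count_mem (val a) s =
   count_mem v (map h s))%N.
Proof.
elim: s => [|x s IH] /=; first by rewrite big1.
case/andP=> Qx /IH <-; rewrite big_split /=; congr (_ + _)%N.
have [hx|hx] := eqVneq (h x) v; last first.
  rewrite big1 // => a /eqP ha; case: eqP => // xa.
  by rewrite xa ha eqxx in hx.
rewrite (bigD1 (exist Q x Qx)) /= ?hx // eqxx big1 ?addn0 // => a /andP[_ ax].
by case: eqP => // xa; case/eqP: ax; apply: val_inj.
Qed.

Lemma map_fst_arcs {T : Type} (x : T) (p : seq T) :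
  map fst (pairmap pair x p) = belast x p.
Proof. by elim: p x => //= y p IH x; rewrite IH. Qed.

Lemma map_snd_arcs {T : Type} (x : T) (p : seq T) :
  map snd (pairmap pair x p) = p.
Proof. by elim: p x => //= y p IH x; rewrite IH. Qed.

Lemma all_arcs {T : Type} (e : rel T) (x : T) (p : seq T) :
  all (fun a => e a.1 a.2) (pairmap pair x p) = path e x p.
Proof. by elim: p x => //= y p IH x; rewrite IH. Qed.

Section RouteFlow.
Context {R : realType} {n m : nat} {Abar : 'M[bool]_n}.
Context (Bbar : 'M[bool]_(n, m)) {I : finType} (p : I -> seq (net_vertex Abar Bbar)).
Let V := net_vertex Abar Bbar.
Hypothesis p_path : forall a, path (@net_rel n m Abar Bbar) (Source : V) (p a).
Hypothesis p_last : forall a, last (Source : V) (p a) = (Sink : V).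

(** The number of times that the routes traverse [e]. Counting occurrences
    rather than testing membership makes conservation hold for all routes,
    whether or not they repeat vertices. *)
Definition load (e : net_edge Abar Bbar) : nat :=
  \sum_a count_mem (val e) (pairmap pair (Source : V) (p a)).

Definition visits (v : V) : nat := \sum_a count_mem v (p a).

Definition route_flow (e : net_edge Abar Bbar) : R := (load e)%:R.

Lemma inflow_route (v : V) : inflow route_flow v = (visits v)%:R.
Proof.
rewrite /inflow -natr_sum; congr (_%:R); rewrite exchange_big /=.
apply: eq_bigr => a _; rewrite -[in RHS](map_snd_arcs (Source : V) (p a)).
by apply: sum_count_mem; rewrite all_arcs.
Qed.

Lemma outflow_route (v : V) :
  outflow route_flow v = (\sum_a count_mem v (belast (Source : V) (p a)))%N%:R.
Proof.
rewrite /outflow -natr_sum; congr (_%:R); rewrite exchange_big /=.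
apply: eq_bigr => a _; rewrite -map_fst_arcs.
by apply: sum_count_mem; rewrite all_arcs.
Qed.

(** A route leaves each vertex as often as it enters it, up to its two ends. *)
Lemma count_belast (v : V) (a : I) : v <> Sink ->
  count_mem v (belast (Source : V) (p a)) =
  ((v == (Source : V)) + count_mem v (p a))%N.
Proof.
move=> vt; rewrite -[RHS]/(((v == Source) + count_mem v (p a))%N).
have := congr1 (count_mem v) (lastI (Source : V) (p a)).
rewrite p_last -cats1 count_cat /= [Source == v]eq_sym => ->.
by have /eqP/negbTE := vt; rewrite [Sink == v]eq_sym => ->; rewrite !addn0.
Qed.

Lemma route_conservation (v : V) : v <> Source -> v <> Sink ->
  outflow route_flow v = inflow route_flow v.
Proof.
move=> vs vt; rewrite outflow_route inflow_route; congr (_%:R).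
apply: eq_bigr => a _; rewrite count_belast //.
by move/eqP/negbTE: vs => ->.
Qed.

Lemma load_visits_head (e : net_edge Abar Bbar) : (load e <= visits (Defs.head e))%N.
Proof.
apply: leq_sum => a _; rewrite -[in leqRHS](map_snd_arcs (Source : V) (p a)).
by rewrite count_map; apply: sub_count => x /eqP ->; rewrite /= /Defs.head.
Qed.

Lemma load_visits_tail (e : net_edge Abar Bbar) : tail e <> Source -> tail e <> Sink ->
  (load e <= visits (tail e))%N.
Proof.
move=> es et; apply: leq_sum => a _.
have <- : count_mem (tail e) (belast (Source : V) (p a)) = count_mem (tail e) (p a).
  by rewrite count_belast //; move/eqP/negbTE: es => ->.
rewrite -map_fst_arcs count_map; apply: sub_count => x /eqP ->.
by rewrite /= /tail.
Qed.

Lemma route_flow_value : (forall a, (Source : V) \notin p a) ->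
  flow_value route_flow = #|I|%:R.
Proof.
move=> ps; rewrite /flow_value outflow_route; congr (_%:R).
transitivity (\sum_(a : I) 1)%N; last by rewrite sum1_card.
apply: eq_bigr => a _; rewrite count_belast // eqxx.
by apply/eqP; rewrite eqSS; apply/eqP/count_memPn; exact: ps.
Qed.
End RouteFlow.

(** * From a controlling input set to a flow *)

Lemma sum_pred_le1 {T : finType} (P : pred T) :
  (forall x y, P x -> P y -> x = y) -> (\sum_x P x <= 1)%N.
Proof.
move=> Pinj; rewrite -big_mkcond sum1_card.
by apply/card_le1_eqP => x y Px Py; exact: Pinj.
Qed.

Section InputRoutes.
Context {R : realType} {n m : nat} {Abar : 'M[bool]_n} {Bbar : 'M[bool]_(n, m)}.
Context {h : 'I_#|ntl_sccs Abar| -> 'I_m} {g : 'I_n -> 'I_n + 'I_m}.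
Hypothesis h_input : forall i, [exists r in ntl_scc i, Bbar r (h i)].
Hypothesis g_inj : injective g.
Hypothesis g_edge : forall k, feeds Abar Bbar (g k) k.
Let V := net_vertex Abar Bbar.

(** The route serving a component goes through the input [h] that drives one of
    its states; the route serving a state goes through its match under [g]. *)
Definition input_route (a : 'I_#|ntl_sccs Abar| + 'I_n) : seq V :=
  match a with
  | inl i => [:: SccV i; InputR (h i); Sink]
  | inr k =>
      StateL k :: match g k with
                  | inl r => [:: StateR r; Sink]
                  | inr j => [:: InputL j; InputR j; Sink]
                  end
  end.

Lemma input_route_path (a : 'I_#|ntl_sccs Abar| + 'I_n) :
  path (@net_rel n m Abar Bbar) (Source : V) (input_route a).
Proof.
case: a => [i|k] /=; first by rewrite h_input.
by have := g_edge k; rewrite /feeds; case: (g k) => [r|j] /= ->; rewrite ?eqxx.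
Qed.

Lemma input_route_last (a : 'I_#|ntl_sccs Abar| + 'I_n) :
  last (Source : V) (input_route a) = (Sink : V).
Proof. by case: a => [i|k] //=; case: (g k). Qed.

Lemma mem_input_route (v : V) (a : 'I_#|ntl_sccs Abar| + 'I_n) :
  v \in input_route a ->
  match v, a with
  | SccV i, inl i' => i = i'
  | StateL k, inr k' => k = k'
  | StateR r, inr k => g k = inl r
  | InputL j, inr k => g k = inr j
  | InputR j, inl i => h i = j
  | InputR j, inr k => g k = inr j
  | Sink, _ => True
  | _, _ => False
  end.
Proof.
case: a => [i|k] /=; first by rewrite !inE => /or3P[] /eqP ->.
rewrite inE => /predU1P[-> //|]; case: (g k) => [r|j]; rewrite !inE.
  by case/orP => /eqP ->.
by case/or3P => /eqP ->.
Qed.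

Lemma visits_input_route (v : V) :
  visits Bbar input_route v = (\sum_a (v \in input_route a))%N.
Proof.
by apply: eq_bigr => a _; apply: count_uniq_mem; case: a => [i|k] //=; case: (g k).
Qed.

(** Component and left state vertices lie on their own route only; the right
    state and left input vertices are not shared because [g] is injective. *)
Lemma visits_le1 (v : V) : v <> Sink -> (forall j, v <> InputR j) ->
  (visits Bbar input_route v <= 1)%N.
Proof.
move=> vt vI; rewrite visits_input_route; apply: sum_pred_le1.
move=> a b /mem_input_route va /mem_input_route; move: va.
case: v vt vI => [||i|k|r|j|j] // _ vI; last by have := vI j.
- by case: a b => [i'|k'] [i''|k''] // <- <-.
- by case: a b => [i'|k'] [i''|k''] // <- <-.
- by case: a b => [i'|k'] [i''|k''] // <- /g_inj ->.
- by case: a b => [i'|k'] [i''|k''] // <- /g_inj ->.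
Qed.

(** At most [n] component routes pass through [InputR j], and at most one state
    route because [g] is injective. *)
Lemma visits_InputR (j : 'I_m) :
  (visits Bbar input_route (InputR j : V) <= n.+1)%N.
Proof.
rewrite visits_input_route big_sumType /= -addn1 leq_add //.
  apply: (@leq_trans (\sum_(i < #|ntl_sccs Abar|) 1)).
    by apply: leq_sum => i _; apply: leq_b1.
  by rewrite sum1_card card_ord card_ntl_sccs.
apply: sum_pred_le1 => k k' /(mem_input_route _ (inr k)) gk.
by move=> /(mem_input_route _ (inr k')); rewrite -gk => /g_inj.
Qed.

Lemma input_route_feasible :
  MCFF_feasible (#|ntl_sccs Abar| + n) (route_flow (R := R) Bbar input_route).
Proof.
split; last first.
  rewrite route_flow_value ?card_sum ?card_ord //.
  - exact: input_route_path.
  - exact: input_route_last.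
  - by move=> a; apply/negP => /mem_input_route; case: a.
split=> [e|e|v vs vt].
- exact: ler0n.
- have lt := load_visits_tail Bbar input_route input_route_last e.
  have lh := load_visits_head Bbar input_route e.
  rewrite /capacity /route_flow; move: lt lh.
  have one v k : v <> Sink -> (forall j, v <> InputR j) ->
      (k <= visits Bbar input_route v)%N -> k%:R <= 1 :> R.
    by move=> vt vI /leq_trans/(_ (visits_le1 _ vt vI)); rewrite -(ler_nat R).
  case: e => -[v w] vw; rewrite /tail /Defs.head /=.
  (* The edges out of the source are bounded through their heads. *)
  case: v vw => [||i|k|r|j|j] // vw lt lh; try by apply: one (lt _ _).
    by case: w vw lt lh => [||i|k|r|j|j] // vw lt; apply: one.
  case: w vw lt lh => [||i|k|r|j'|j'] // vw lt _.
  by rewrite ler_nat (leq_trans (lt _ _)) ?visits_InputR.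
- by apply: route_conservation; [exact: input_route_path|exact: input_route_last|..].
Qed.

Lemma input_route_selected (j : 'I_m) :
  j \in selected_inputs (route_flow (R := R) Bbar input_route) ->
  (exists i, h i = j) \/ (exists k, g k = inr j).
Proof.
rewrite inE ltr0n => lj.
have : (0 < visits Bbar input_route (InputR j : V))%N.
  by apply: leq_trans lj (load_visits_tail _ _ input_route_last _ _ _).
rewrite visits_input_route lt0n sum_nat_eq0 => /forallPn[a].
rewrite eqb0 negbK => /mem_input_route.
by case: a => [i|k] ?; [left; exists i|right; exists k].
Qed.
End InputRoutes.

(** The two necessary conditions apply to the restricted system, whose inputs
    are numbered by ['I_#|W|]; [enum_val] sends them back into [W]. *)
Lemma controlling_flow {R : realType} {n m : nat} {Abar : 'M[bool]_n}
    {Bbar : 'M[bool]_(n, m)} {W : {set 'I_m}} :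
  controlling_inputs R Abar Bbar W ->
  exists2 f : net_edge Abar Bbar -> R,
    MCFF_feasible (#|ntl_sccs Abar| + n) f & selected_inputs f \subset W.
Proof.
move=> ctrl.
have /fin_all_exists[h hP] (i : 'I_#|ntl_sccs Abar|) :
    exists j, [exists r in ntl_scc i, restrict_inputs Bbar W r j].
  exact: ntl_scc_input ctrl (enum_valP i).
have [g g_inj gP] := state_matching ctrl.
pose g' k : 'I_n + 'I_m :=
  match g k with inl r => inl r | inr j => inr (enum_val j) end.
have hP' i : [exists r in ntl_scc i, Bbar r (enum_val (h i))].
  by have /existsP[r] := hP i; rewrite mxE => rP; apply/existsP; exists r.
have g'_inj : injective g'.
  move=> k l; rewrite /g' => E; apply: g_inj; move: E.
  by case: (g k) (g l) => [r|j] [r'|j'] // [] => [-> //|/enum_val_inj ->].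
have g'P k : feeds Abar Bbar (g' k) k.
  by have := gP k; rewrite /g' /feeds; case: (g k) => // j; rewrite mxE.
exists (route_flow Bbar (input_route (h := fun i => enum_val (h i)) (g := g'))).
  exact: input_route_feasible hP' g'_inj g'P.
apply/fintype.subsetP => j /input_route_selected[[i <-]|[k]]; first exact: enum_valP.
by rewrite /g'; case: (g k) => // j' [<-]; exact: enum_valP.
Qed.

(** * Comparison of the two optima *)

(** Only the edges out of the vertices [InputR j] have a nonzero cost. *)
Lemma flow_costE {R : realType} {n m : nat} {Abar : 'M[bool]_n}
    {Bbar : 'M[bool]_(n, m)} (pu : 'I_m -> R) (f : net_edge Abar Bbar -> R) :
  flow_cost pu f = input_cost pu (selected_inputs f).
Proof.
pose input (e : net_edge Abar Bbar) : option 'I_m :=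
  match tail e with InputR j => Some j | _ => None end.
rewrite /flow_cost (bigID (fun e => isSome (input e))) /=.
rewrite [X in _ + X]big1 ?addr0 => [|e /andP[_]]; last first.
  by rewrite /input /edge_cost; case: (tail e).
rewrite (reindex_omap (input_sink_edge Abar Bbar) input) /=; last first.
  case=> -[v w] vw; rewrite /input /tail /=.
  case: v vw => [||i|k|r|j|j] // vw /andP[_ //] _.
  case: w vw => [||i|k|r|j'|j'] // vw.
  by congr Some; apply: val_inj.
by apply: eq_big => j; rewrite ?inE /input /= ?eqxx ?andbT.
Qed.

Lemma minCCIS_opt_attained {R : realType} {n m : nat} {Abar : 'M[bool]_n}
    {Bbar : 'M[bool]_(n, m)} (pu : 'I_m -> R) :
  structurally_controllable R Abar Bbar ->
  exists2 W, controlling_inputs R Abar Bbar W &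
    minCCIS_opt Abar Bbar pu = input_cost pu W.
Proof.
move=> ctrl.
have K_neq0 : (controlling_inputs R Abar Bbar !=set0)%classic.
  by exists [set: 'I_m]%SET; apply: structurally_controllable_setT.
by have [W KW [optE _]] := minimum_attained (input_cost pu) _ K_neq0; exists W.
Qed.

(** There can be infinitely many feasible flows, but the cost of a flow depends
    only on the input set that it selects, so the minimum is attained. *)
Lemma MCFF_opt_le {R : realType} {n m : nat} {Abar : 'M[bool]_n}
    {Bbar : 'M[bool]_(n, m)} (pu : 'I_m -> R) {d : nat}
    {f : net_edge Abar Bbar -> R} :
  MCFF_feasible d f -> MCFF_opt Abar Bbar pu d <= flow_cost pu f.
Proof.
move=> feas; rewrite flow_costE.
pose S := (@selected_inputs R n m Abar Bbar @` @MCFF_feasible R n m Abar Bbar d)%classic.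
have Sf : S (selected_inputs f) by exists f.
have -> : MCFF_opt Abar Bbar pu d = minimum (input_cost pu @` S)%classic.
  rewrite /S image_comp; congr (minimum (image _ _)).
  by apply/funext => g; exact: flow_costE.
have [I _ [-> Imin]] := minimum_attained (input_cost pu) S (ex_intro _ _ Sf).
exact: Imin.
Qed.

Lemma input_cost_subset {R : realType} {m : nat} {pu : 'I_m -> R} {I J : {set 'I_m}} :
  (forall j, 0 <= pu j) -> I \subset J -> input_cost pu I <= input_cost pu J.
Proof.
move=> pu_ge0 IJ; rewrite /input_cost [leRHS](big_setID I) /=.
by rewrite (finset.setIidPr IJ) lerDl sumr_ge0.
Qed.

Theorem theoremV5 (R : realType) (n m : nat)
    (Abar : 'M[bool]_n) (Bbar : 'M[bool]_(n, m))
    (hctrl : structurally_controllable R Abar Bbar)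
    (pu : 'I_m -> R) (hpu : forall j, 0 <= pu j)
    (q : nat) (hq : q = #|ntl_sccs Abar|)
    (f : net_edge Abar Bbar -> R)
    (hf : MCFF_feasible (q + n) f)
    (eps : R) (heps : 1 <= eps) :
  flow_cost pu f <= eps * MCFF_opt Abar Bbar pu (q + n) ->
  input_cost pu (selected_inputs f) <= eps * minCCIS_opt Abar Bbar pu.
Proof.
rewrite -flow_costE => /le_trans; apply.
apply: ler_wpM2l; first exact: le_trans ler01 heps.
have [W Wctrl ->] := minCCIS_opt_attained pu hctrl.
have [fW fW_feas selW] := controlling_flow Wctrl.
rewrite -hq in fW_feas; apply: le_trans (MCFF_opt_le pu fW_feas) _.
by rewrite flow_costE; apply: input_cost_subset hpu selW.
Qed.
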